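(* For every integer $n\ge 2$, the circulant graph $Ci_{2n+1}(n-1,n)$ is an MPF graph.
   Context: The circulant graph $Ci_{2n+1}(n-1,n)$ is the graph on the vertex set $\{0,1,\ldots,2n\}$ whose edges are $i\sim i+n-1 \pmod{2n+1}$ and $i\sim i+n \pmod{2n+1}$ for each vertex $i$. All graphs are finite. A simple graph is an undirected graph without loops or multiple edges. A labeling of a graph on $N$ vertices is a bijection from its vertex set to an $N$-element index set such as $\{1,\ldots,N\}$; it determines the adjacency matrix $A(\cdot)$. A simple graph $X$ on $N$ vertices is an MPF (matrix product factorizable) graph if there exist simple graphs $G$ and $H$ on $N$ vertices and labelings of $G$, $H$ and $X$ such that, with respect to these labelings, $A(G)A(H)=A(X)$. *)

(* Defs.v *)
From mathcomp Require Import all_boot all_order all_algebra.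
From mathcomp Require Import zify.

Set Implicit Arguments.
Unset Strict Implicit.
Unset Printing Implicit Defensive.

Record sgraph := SGraph {
  vertex :> finType;
  edge : rel vertex;
  edge_sym : symmetric edge;
  edge_irrefl : irreflexive edge
}.

(* A bijection V -> 'I_N, stored together with its two-sided inverse so that
   adjacency matrices can be written entrywise. *)
Record labeling (V : finType) (N : nat) := Labeling {
  label : V -> 'I_N;
  unlabel : 'I_N -> V;
  labelK : cancel label unlabel;
  unlabelK : cancel unlabel label
}.

Definition adjacency (G : sgraph) (N : nat) (l : labeling G N) : 'M[int]_N :=
  (\matrix_(i, j) (edge (unlabel l i) (unlabel l j))%:R)%R.

(* The cardinality conditions also follow from the existence of the labelings. *)
Definition MPF (X : sgraph) : Prop :=
  exists G H : sgraph,
    [/\ #|G| = #|X|, #|H| = #|X| &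
      exists (lG : labeling G #|X|) (lH : labeling H #|X|)
             (lX : labeling X #|X|),
        (adjacency lG *m adjacency lH)%R = adjacency lX].

Section Circulant.
Variable n : nat.
Local Notation N := (2 * n + 1).

Definition circulant_edge : rel 'I_N := fun i j =>
  [|| j == i + (n - 1) %[mod N], j == i + n %[mod N],
      i == j + (n - 1) %[mod N] | i == j + n %[mod N]].

Lemma circulant_edge_sym : symmetric circulant_edge.
Proof.
move=> i j; rewrite /circulant_edge.
by do 4!case: (_ == _ %[mod _]).
Qed.

(* For n = 1 the jump n - 1 is 0 and every vertex would carry a loop. *)
Lemma circulant_edge_irrefl : 2 <= n -> irreflexive circulant_edge.
Proof.
move=> hn i.
have H s : 0 < s < N -> (i == i + s %[mod N]) = false.
  move=> /andP[s0 sN]; apply/negbTE.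
  by rewrite -{1}[val i]addn0 eqn_modDl mod0n modn_small // eq_sym -lt0n.
by rewrite /circulant_edge !H //; lia.
Qed.

Definition Ci (hn : 2 <= n) : sgraph :=
  SGraph circulant_edge_sym (circulant_edge_irrefl hn).
End Circulant.

(* Main.v *)
Require Import Defs.
From mathcomp Require Import all_boot all_order all_algebra.
From mathcomp Require Import zify.

(** The idea is a factorization in a group ring. Write [C(S)] for the Cayley
    graph of a finite abelian group with symmetric connection set [S]. Its
    adjacency matrix is the image of [\sum_(s in S) x^s] under the regular
    representation, so products of such matrices follow from
      [(x^a + x^-a) (x^b + x^-b) = x^(a+b) + x^(a-b) + x^(b-a) + x^-(a+b)].
    As soon as the four exponents on the right are distinct, no entry of the
    product exceeds 1, and [A(C(a, -a)) A(C(b, -b))] is the adjacency matrix of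
    the Cayley graph with these four exponents as connection set
    ([cayley_MPF]). In the integers modulo [2n+1], take [a = n] and [b = 1]:
    then [a - b = n - 1], while [a + b = n + 1 = - n], so the four exponents
    are exactly [n - 1], [n] and their opposites ([jumps_Ci]). *)

Set Implicit Arguments.
Unset Strict Implicit.
Unset Printing Implicit Defensive.

Import GRing.Theory.

Section CayleyProduct.
Local Open Scope ring_scope.
Variable T : finZmodType.
Implicit Types a b x y : T.

Definition cayley_edge a : rel T := fun x y => (y == x + a) || (y == x - a).

Lemma cayley_edge_sym a : symmetric (cayley_edge a).
Proof.
move=> x y; have E c : (y == x + c) = (x == y - c) by rewrite -subr_eq eq_sym.
by rewrite /cayley_edge !E opprK orbC.
Qed.

Lemma cayley_edge_irrefl a : a != 0 -> irreflexive (cayley_edge a).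
Proof.
move=> a0 x; have E c : (x == x + c) = (c == 0).
  by rewrite -{1}[x]addr0 (inj_eq (addrI x)) eq_sym.
by rewrite /cayley_edge !E oppr_eq0 (negPf a0).
Qed.

Definition cayley_graph a (a0 : a != 0) : sgraph :=
  SGraph (cayley_edge_sym a) (cayley_edge_irrefl a0).

(** The exponents in the expansion of [(x^a + x^-a) (x^b + x^-b)], with multiplicity. *)
Definition jumps a b : seq T := [:: a + b; a - b; b - a; - (a + b)].

Lemma cayley_edge_natr a x y : a != - a ->
  (cayley_edge a x y)%:R = (y == x + a)%:R + (y == x - a)%:R :> int.
Proof.
move=> aNa; rewrite /cayley_edge; have [->|_] /= := eqVneq y (x + a).
  by rewrite (inj_eq (addrI x)) (negPf aNa) addr0.
by rewrite add0r.
Qed.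

(** An element equal to its opposite would make two of the sums coincide, so
    distinctness of the jumps alone yields loopless factors whose steps [a],
    [- a] (and [b], [- b]) are really two different steps. *)
Lemma uniq_jumps_neqN a b : uniq (jumps a b) -> a != - a /\ b != - b.
Proof.
rewrite /= !inE !negb_or => /andP[/and3P[h1 h2 _] _]; split.
  by apply: contra h2 => /eqP ea; rewrite {1}ea addrC.
by apply: contra h1 => /eqP eb; rewrite {1}eb.
Qed.

Lemma neqN_neq0 a : a != - a -> a != 0.
Proof. by apply: contraNneq => ->; rewrite oppr0. Qed.

(** The sum counts walks from [x] to [y] made of a step [a] or [- a] and then a
    step [b] or [- b]. Such a walk is determined by its two steps, so the count
    is the multiplicity of [y - x] among the jumps, which uniqueness bounds
    by 1. *)
Lemma cayley_walks a b x y : uniq (jumps a b) ->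
  \sum_(t : T) (cayley_edge a x t)%:R * (cayley_edge b t y)%:R
    = (y - x \in jumps a b)%:R :> int.
Proof.
move=> Uab; have [aNa bNb] := uniq_jumps_neqN Uab.
have pick u : \sum_(t : T) (cayley_edge a x t)%:R * (t == u)%:R
    = (cayley_edge a x u)%:R :> int.
  rewrite (bigD1 u) //= eqxx mulr1 big1 ?addr0 // => t /negPf ->.
  by rewrite mulr0.
under eq_bigr => t _ do
  rewrite [cayley_edge b _ _]cayley_edge_sym (cayley_edge_natr _ _ bNb) mulrDr.
rewrite big_split /= !pick !(cayley_edge_natr _ _ aNa) -count_uniq_mem //=.
have shift u v : (y + u == x + v) = (v - u == y - x).
  by rewrite [RHS]eq_sym subr_eq addrAC [RHS]eq_sym subr_eq eq_sym [v + x]addrC.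
rewrite !shift !opprK -opprD [- a + b]addrC addn0 !natrD.
by rewrite addrC addrACA -addrA.
Qed.

(** Labeling [X] arbitrarily and carrying the labels over to [T] along [f]
    makes all three matrices indexed by the same group elements. *)
Lemma cayley_MPF (X : sgraph) (f : X -> T) a b :
    bijective f -> uniq (jumps a b) ->
    (forall x y : X, edge x y = (f y - f x \in jumps a b)) ->
  MPF X.
Proof.
move=> [g fK gK] Uab edgeX; have [aNa bNb] := uniq_jumps_neqN Uab.
have cardT : #|T| = #|X| by apply/esym/bij_eq_card; exists g.
exists (cayley_graph (neqN_neq0 aNa)), (cayley_graph (neqN_neq0 bNb)).
split=> //.
have lK : cancel (enum_rank \o g) (f \o enum_val).
  by move=> t /=; rewrite enum_rankK.
have ulK : cancel (f \o enum_val) (enum_rank \o g).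
  by move=> i /=; rewrite fK enum_valK.
exists (Labeling lK ulK), (Labeling lK ulK).
exists (Labeling (@enum_rankK X) (@enum_valK X)).
apply/matrixP => i j; rewrite !mxE /= edgeX -(cayley_walks _ _ Uab).
rewrite [RHS](reindex (fun k : 'I_#|X| => f (enum_val k))) /=; last first.
  by exists (enum_rank \o g) => k _; [exact: ulK|exact: lK].
by apply: eq_bigr => k _; rewrite !mxE.
Qed.

End CayleyProduct.

Section Residues.
Local Open Scope ring_scope.

Lemma eq_Zp_nat p (p_gt1 : (1 < p)%N) (i j : nat) :
  (i%:R == j%:R :> 'Z_p) = (i == j %[mod p])%N.
Proof. by rewrite -val_eqE /= !val_Zp_nat. Qed.

Lemma Zp_nat_bij p (p_gt1 : (1 < p)%N) :
  bijective (fun i : 'I_p => (i : nat)%:R : 'Z_p).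
Proof.
apply: inj_card_bij => [i j /eqP|]; last by rewrite !card_ord Zp_cast.
by rewrite eq_Zp_nat // !modn_small // => /eqP /val_inj.
Qed.

(** Here [a + b = n + 1] is [- n], because the modulus is [2n+1]; the four sums
    therefore collapse to the circulant jumps and their opposites. *)
Lemma jumps_Ci n : (1 < n)%N ->
  jumps (n%:R : 'Z_(2 * n + 1)) 1
    = [:: - n%:R; (n - 1)%:R; - (n - 1)%:R; n%:R].
Proof.
move=> n_gt1; have nN : n%:R + 1 = - n%:R :> 'Z_(2 * n + 1).
  apply/eqP; rewrite -addr_eq0 addrAC -natrD natr1.
  by rewrite (_ : (n + n).+1 = 2 * n + 1)%N ?pchar_Zp //; lia.
by rewrite /jumps nN opprK natrB ?opprB //; lia.
Qed.

(** The least residues of the four jumps are [n + 1], [n - 1], [n + 2] and [n];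
    for [n > 1] all of them are below the modulus. *)
Lemma uniq_jumps_Ci n : (1 < n)%N -> uniq (jumps (n%:R : 'Z_(2 * n + 1)) 1).
Proof.
move=> n_gt1; have p_gt1 : (1 < 2 * n + 1)%N by lia.
have oppE k : (k <= 2 * n + 1)%N ->
    - k%:R = (2 * n + 1 - k)%:R :> 'Z_(2 * n + 1).
  by move=> le_k; rewrite natrB // pchar_Zp // sub0r.
rewrite jumps_Ci // !oppE; try lia.
by rewrite /= !inE !eq_Zp_nat // !modn_small; lia.
Qed.

End Residues.

Theorem proposition3p39 (n : nat) (hn : 2 <= n) : MPF (@Ci n hn).
Proof.
have p_gt1 : (1 < 2 * n + 1)%N by lia.
apply: (@cayley_MPF _ (Ci hn) _ n%:R%R 1%R (Zp_nat_bij p_gt1)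
  (uniq_jumps_Ci hn)).
move=> i j; rewrite jumps_Ci // !inE /edge /= /circulant_edge.
rewrite -!eq_Zp_nat // !natrD.
have forward (x y c : 'Z_(2 * n + 1)) : (y - x == c)%R = (y == x + c)%R.
  by rewrite subr_eq addrC.
have backward (x y c : 'Z_(2 * n + 1)) : (y - x == - c)%R = (x == y + c)%R.
  by rewrite forward eq_sym subr_eq.
rewrite !backward !forward.
by do 4!case: (_ == _).
Qed.
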